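(* Let $X_1,X_2,\dots$ be independent integer-valued random variables with common distribution function $F(x)=P(X_1\le x)$, where $F$ is not concentrated on a half-axis, and let $S_0=0$, $S_n=X_1+\cdots+X_n$. Suppose $\mathbb E[X_1]<0$ and that for some $0<\xi<1$ and $0<r<1$, \[ P(X_1\le x)=\xi\, r^{-x},\qquad x=0,-1,-2,\dots. \] Define $p=P(\sup_n S_n>0)$, the measure $L$ on Borel subsets $A\subset(0,\infty)$ by \[ L(A)=\sum_{n=1}^\infty P\Big(\max_{0\le k<n}S_k=0<S_n\in A\Big), \] and \[ \zeta=\sum_{n=1}^\infty P\Big(\max_{1\le k<n}S_k<0,\ S_n=0\Big) \] (the probability that the first weak ladder height, i.e. the value $S_n$ at the first $n\ge1$ with $S_n\ge0$, exists and equals $0$). Then \[ (1-\zeta)\,p=r+(1-r)\,\mathbb E[X_1], \] and for $x=1,2,\dots$, \[ (1-\zeta)\,L(0,x]=F(x)-F(0)+(1-r)\sum_{m=1}^{x}\big(1-F(m)\big). \]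
   Context: For $n=1$ the condition $\max_{1\le k<n}S_k<0$ is vacuous. *)

(* Defs.v *)
From HB Require Import structures.
From mathcomp Require Import all_boot all_order all_algebra.
From mathcomp Require Import all_classical all_reals all_analysis.
Set Implicit Arguments. Unset Strict Implicit. Unset Printing Implicit Defensive.
Import Order.TTheory GRing.Theory Num.Theory.
Local Open Scope classical_set_scope.
Local Open Scope ring_scope.

Section defs.
Context {d : measure_display} {T : measurableType d} {R : realType}.

(* Mutual independence of a sequence of real random variables:
   for every n and every family of Borel sets B_0,...,B_{n-1},
   P(X_0 in B_0, ..., X_{n-1} in B_{n-1}) = prod_i P(X_i in B_i).
   (Taking B_i = setT recovers every finite subfamily.) *)
Definition mutually_independent (P : probability T R) (X : nat -> T -> R) : Prop :=
  forall (n : nat) (B : nat -> set R), (forall i, measurable (B i)) ->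
    P (\bigcap_(i in `I_n) (X i @^-1` B i)) = (\prod_(i < n) P (X i @^-1` B i))%E.

(* all X_n have the same distribution as X_0 (= X_1 in the paper's indexing) *)
Definition identically_distributed (P : probability T R) (X : nat -> T -> R) : Prop :=
  forall (n : nat) (B : set R), measurable B -> P (X n @^-1` B) = P (X 0%N @^-1` B).

Definition S (X : nat -> T -> R) (n : nat) (w : T) : R := \sum_(i < n) X i w.

Definition Fdist (P : probability T R) (X : nat -> T -> R) (x : R) : \bar R :=
  P [set w | X 0%N w <= x].

Definition p_sup (P : probability T R) (X : nat -> T -> R) : \bar R :=
  P [set w | exists n, 0 < S X n w].

Definition Lmeas (P : probability T R) (X : nat -> T -> R) (A : set R) : \bar R :=
  (\sum_(1 <= n <oo)
     P [set w | \big[Num.max/S X 0 w]_(k < n) S X k w = 0%R /\ (0 < S X n w)%R /\ A (S X n w)])%E.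

(* zeta = sum_{n>=1} P(max_{1<=k<n} S_k < 0, S_n = 0)  (max over empty range: vacuous) *)
Definition zeta (P : probability T R) (X : nat -> T -> R) : \bar R :=
  (\sum_(1 <= n <oo)
     P [set w | (forall k : nat, (1 <= k < n)%N -> (S X k w < 0)%R) /\ S X n w = 0%R])%E.

End defs.

(* Main.v *)
Require Import Defs.
From HB Require Import structures.
From mathcomp Require Import all_boot all_order all_algebra.
From mathcomp Require Import all_classical all_reals all_analysis.
From mathcomp Require Import measurable_realfun.
From mathcomp Require Import ring lra.
Import Order.TTheory GRing.Theory Num.Theory.
Local Open Scope classical_set_scope.
Local Open Scope ring_scope.

(** Cutting a path just before it first leaves the half-line below a barrier
    turns [zeta], [L] and [p] into sums over positions [i] below the barrier of
    (expected number of visits to [i] before leaving) times (probability of a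
    suitable jump from [i]).  The visit counts satisfy a linear renewal
    equation, and the geometric lower tail makes it have a constant solution:
    the probability that the first step ends at distance [j] below the barrier
    is proportional to [r ^ j.+1], as is the mass missing from the [j]-th column
    of the kernel.  The negative mean shows that the visit counts are the constant
    solution, and not a smaller one, through the explicit potential
    [j + 1 / (1 - r)].  The constant is [1 - r] for the barrier [S < 0], so that
    [zeta = 1 - r], and [(1 - r) / r] for the barrier [S <= 0]. *)

Lemma nneseries_recS {R : realType} (f : nat -> \bar R) :
  (forall i, 0 <= f i)%E ->
  (\sum_(i <oo) f i = f 0%N + \sum_(i <oo) f i.+1)%E.
Proof.
move=> f0; rewrite nneseries_recl// -nneseries_addn//; congr (_ + _)%E.
by apply: eq_eseriesr => i _; rewrite addn1.
Qed.

(** * Occupation measures of a chain with killing *)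

Section killed_chain.
Local Open Scope ereal_scope.
Context {R : realType} {k : nat -> nat -> \bar R}.
Hypothesis k_ge0 : forall i j, 0 <= k i j.

(* [k i j] is here the probability of a jump from [j] to [i]: the occupation
   measures [g] below evolve under the time-reversed chain. *)
Fixpoint survival (n j : nat) : \bar R :=
  if n is m.+1 then \sum_(i <oo) survival m i * k i j else 1.

Lemma survival_ge0 n j : 0 <= survival n j.
Proof.
by elim: n j => //= n IH j; apply: nneseries_ge0 => i _ _; rewrite mule_ge0.
Qed.

(** A Foster-type bound: one step lowers the nonnegative potential [V] by [mu] on average, so [mu]
    times the expected lifetime from [j] cannot exceed [V j]. *)
Lemma survival_potential (V : nat -> \bar R) (mu : R) :
  (0 <= mu)%R -> (forall j, 0 <= V j) ->
  (forall j, mu%:E + \sum_(i <oo) V i * k i j = V j) ->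
  forall N j, mu%:E * \sum_(0 <= n < N) survival n j <= V j.
Proof.
move=> mu0 V0 HV; elim=> [|N IH] j; first by rewrite big_geq// mule0.
rewrite big_nat_recl//= -nneseries_sum_nat; last first.
  by move=> *; rewrite mule_ge0// survival_ge0.
rewrite ge0_muleDr//; last first.
  apply: nneseries_ge0 => i _ _; apply: sume_ge0 => n _.
  by rewrite mule_ge0// survival_ge0.
(* With the term [n = 0] split off, both sides begin with [mu]; the remaining series are compared
   term by term through [IH]. *)
rewrite mule1 -[leRHS]HV leeD2l// -nneseriesZl//; last first.
  by move=> i _; apply: sume_ge0 => n _; rewrite mule_ge0// survival_ge0.
apply: lee_nneseries => [i _ _|i _].
  rewrite mule_ge0// sume_ge0// => n _; rewrite mule_ge0// survival_ge0//.
rewrite -ge0_sume_distrl; last by move=> *; exact: survival_ge0.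
by rewrite muleA lee_wpmul2r.
Qed.

(* [c * survival n = g n + c * survival n.+1], so that the sum of the [g n]
   telescopes; the potential [V] makes the survival probabilities summable. *)
Lemma killed_chain_occupation (V : nat -> \bar R) (mu c : R) (q : nat -> R)
    (g : nat -> nat -> \bar R) :
  (0 < mu)%R -> (0 <= c)%R ->
  (forall j, V j \is a fin_num) -> (forall j, 0 <= V j) ->
  (forall j, mu%:E + \sum_(i <oo) V i * k i j = V j) ->
  (forall j, (q j)%:E + \sum_(i <oo) k i j = 1) ->
  (forall n j, 0 <= g n j) ->
  (forall j, g 0%N j = (c * q j)%:E) ->
  (forall n j, g n.+1 j = \sum_(i <oo) g n i * k i j) ->
  forall j, \sum_(n <oo) g n j = c%:E.
Proof.
move=> mu0 c0 Vfin V0 HV Hq g_ge0 g0 gS j.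
have decomp n i : c%:E * survival n i = g n i + c%:E * survival n.+1 i.
  elim: n i => [|n IH] i /=.
    under eq_eseriesr do rewrite mul1e.
    by rewrite g0 EFinM -muleDr ?fin_num_adde_defr// Hq.
  rewrite gS -!nneseriesZl; last 2 first.
  - by move=> m _; rewrite mule_ge0// (survival_ge0 n.+1).
  - by move=> m _; rewrite mule_ge0// survival_ge0.
  rewrite -nneseriesD; last 2 first.
  - by move=> m _ _; rewrite mule_ge0.
  - by move=> m _ _; rewrite mule_ge0// mule_ge0// (survival_ge0 n.+1).
  apply: eq_eseriesr => m _; rewrite !muleA IH ge0_muleDl//.
  by rewrite mule_ge0// (survival_ge0 n.+1).
have sumfin : \sum_(n <oo) survival n j <= mu^-1%:E * V j.
  apply: lime_le => [|]; first by apply: is_cvg_nneseries => n _ _; exact: survival_ge0.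
  apply: nearW => N.
  rewrite -(@lee_pmul2l _ mu%:E) ?lte_fin//.
  rewrite muleA -EFinM divff ?gt_eqF// mul1e.
  exact: (survival_potential _ _ (ltW mu0) V0 HV).
have sumE : \sum_(n <oo) survival n j = 1 + \sum_(n <oo) survival n.+1 j.
  by rewrite nneseries_recS// => n; exact: survival_ge0.
have tail_ge0 : 0 <= \sum_(n <oo) survival n.+1 j.
  by apply: nneseries_ge0 => n _ _; exact: survival_ge0.
(* Finiteness is what allows this tail, which occurs on both sides of the summed decomposition, to
   be cancelled. *)
have tail_fin : \sum_(n <oo) survival n.+1 j \is a fin_num.
  rewrite ge0_fin_numE//; apply: (@le_lt_trans _ _ (mu^-1%:E * V j)).
    by apply: le_trans sumfin; rewrite sumE leeDr.
  by rewrite ltey_eq fin_numM.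
have : c%:E * \sum_(n <oo) survival n j =
    \sum_(n <oo) g n j + c%:E * \sum_(n <oo) survival n.+1 j.
  rewrite -!nneseriesZl; last 2 first.
  - by move=> n _; exact: (survival_ge0 n.+1).
  - by move=> n _; exact: survival_ge0.
  rewrite -nneseriesD//; first by apply: eq_eseriesr => n _; exact: decomp.
  by move=> n _ _; rewrite mule_ge0// (survival_ge0 n.+1).
rewrite sumE ge0_muleDr// mule1.
move=> /(congr1 (fun x => x - c%:E * \sum_(n <oo) survival n.+1 j)).
by rewrite !addeK ?fin_numM// => <-.
Qed.

End killed_chain.

Lemma measure_bigcup_nat {d} {T : measurableType d} {R : realType}
    (mu : {measure set T -> \bar R}) (A : (set T)^nat) :
  (forall i, measurable (A i)) -> trivIset setT A ->
  mu (\bigcup_i A i) = (\sum_(i <oo) mu (A i))%E.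
Proof.
by move=> mA tA; apply: measure_semi_bigcup => //; exact: bigcup_measurable.
Qed.

(** * Positive part and point masses of an integer-valued variable *)

Section integer_variable.
Context {d : measure_display} {T : measurableType d} {R : realType}.
Local Open Scope ereal_scope.

(** A positive integer [x] exceeds exactly the [x] naturals [0, ..., x - 1]. *)
Lemma maxr0_tail_sum (x : R) : x \is a Num.int ->
  maxe x%:E 0 = \sum_(i <oo) (\1_[set y | i%:R < y]%R x : R)%:E.
Proof.
move=> xi; have [x0|x0] := leP x 0%R.
  rewrite max_r ?lee_fin// eseries0// => i _ _ /=.
  rewrite indicE memNset//= => ix; have := lt_le_trans ix x0.
  by rewrite ltNge ler0n.
have /natrP[n ->] : x \is a Num.nat by rewrite natrEint xi ltW.
rewrite (nneseries_split 0 n)// add0n [X in _ = _ + X]eseries0 ?adde0; last first.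
  by move=> i ni _; rewrite indicE memNset//=; rewrite ltr_nat ltnNge ni.
rewrite (eq_big_nat _ _ (F2 := fun=> 1)); last first.
  by move=> i /andP[_ i_n]; rewrite indicE mem_set//= ltr_nat.
by rewrite max_l ?lee_fin// sumEFin sumr_const_nat subn0.
Qed.

Lemma maxr0_point_sum (x : R) : x \is a Num.int ->
  maxe x%:E 0 = \sum_(i <oo) i%:R%:E * (\1_[set i%:R]%R x : R)%:E.
Proof.
move=> xi; have [x0|x0] := leP x 0%R.
  rewrite max_r ?lee_fin// eseries0// => -[|i] _ _; first by rewrite mul0e.
  rewrite indicE memNset ?mule0//= => xE; move: x0; rewrite xE.
  by rewrite leNgt ltr0n.
have /natrP[n ->] : x \is a Num.nat by rewrite natrEint xi ltW.
rewrite (@nneseriesD1 _ _ n)// [X in _ = _ + X]eseries0 ?adde0; last first.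
  move=> i _ /= ni; rewrite indicE memNset ?mule0//= => /eqP.
  by rewrite eqr_nat eq_sym (negbTE ni).
by rewrite indicE mem_set// mule1 max_l ?lee_fin.
Qed.

Variables (P : probability T R) (Z : T -> R).
Hypothesis Z_meas : measurable_fun setT Z.
Hypothesis Z_int : forall w, Z w \is a Num.int.

Lemma measurable_RV_preimage (B : set R) : measurable B -> measurable (Z @^-1` B).
Proof. by move=> mB; rewrite -[_ @^-1` _]setTI; exact: Z_meas. Qed.

Lemma measurable_gt (a : R) : measurable [set y : R | a < y]%R.
Proof. by rewrite -set_itvoy. Qed.

Lemma integral_RV_indic (B : set R) : measurable B ->
  \int[P]_w (\1_B (Z w) : R)%:E = P (Z @^-1` B).
Proof.
move=> mB; rewrite -[in RHS](setIT (Z @^-1` B)).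
by rewrite -integral_indic//; exact: measurable_RV_preimage.
Qed.

Lemma measurable_RV_indic (B : set R) : measurable B ->
  measurable_fun [set: T] (fun w => (\1_B (Z w) : R)%:E).
Proof.
move=> mB; apply/measurable_EFinP.
by apply: (@measurable_indic _ _ R setT (Z @^-1` B)); exact: measurable_RV_preimage.
Qed.

Lemma expectation_pos_tail :
  \int[P]_w (maxe (Z w)%:E 0) = \sum_(i <oo) P [set w | i%:R < Z w]%R.
Proof.
under eq_integral do rewrite maxr0_tail_sum//.
rewrite integral_nneseries//.
- apply: eq_eseriesr => i _.
  exact: (integral_RV_indic _ (measurable_gt i%:R)).
- move=> i; exact: (measurable_RV_indic _ (measurable_gt i%:R)).
Qed.

Lemma expectation_pos_point :
  \int[P]_w (maxe (Z w)%:E 0) = \sum_(i <oo) i%:R%:E * P [set w | Z w = i%:R]%R.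
Proof.
under eq_integral do rewrite maxr0_point_sum//.
rewrite integral_nneseries//.
- apply: eq_eseriesr => i _; rewrite ge0_integralZl_EFin//.
    by congr (_ * _); exact: integral_RV_indic.
  exact: measurable_RV_indic.
- by move=> i; apply: emeasurable_funM => //; exact: measurable_RV_indic.
Qed.

Lemma sum_point_probability (a : R) : a \is a Num.int ->
  \sum_(i <oo) P [set w | Z w = i%:R + a]%R = P [set w | a <= Z w]%R.
Proof.
move=> aint; rewrite -(measure_bigcup_nat P (fun i => [set w | Z w = i%:R + a]%R)).
- congr (P _); apply/seteqP; split => [w [i _ /= ->]|w /= aZ].
    by rewrite lerDr.
  have /natrP[i Hi] : (Z w - a)%R \is a Num.nat.
    by rewrite natrEint subr_ge0 aZ rpredB.
  by exists i => //=; rewrite -Hi subrK.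
- move=> i; exact: (measurable_RV_preimage [set i%:R + a]%R).
- apply/trivIsetP => i j _ _ ij; apply/seteqP; split=> // w /= [-> /addIr/eqP].
  by rewrite eqr_nat (negbTE ij).
Qed.
End integer_variable.

Lemma intr_ltE {R : archiRealDomainType} (x y : R) :
  x \is a Num.int -> y \is a Num.int -> (x < y) = (x + 1 <= y).
Proof.
move=> /intrP[m ->] /intrP[n ->].
by rewrite -[1]/(1%:~R) -intrD ltr_int ler_int lezD1.
Qed.

(** * Jump law with a geometric lower tail, and its constant occupation measure *)

Section geometric_lower_tail.
Context {d : measure_display} {T : measurableType d} {R : realType}.
Variables (P : probability T R) (Z : T -> R) (xi r : R).
Hypothesis Z_meas : measurable_fun setT Z.
Hypothesis Z_int : forall w, Z w \is a Num.int.
Hypothesis xi01 : 0 < xi < 1.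
Hypothesis r01 : 0 < r < 1.
Hypothesis lower_tail :
  forall k : nat, P [set w | Z w <= - k%:R] = (xi * r ^+ k)%:E.
Hypothesis mean_lt0 : ('E_P[Z] < 0)%E.
Local Open Scope ereal_scope.

Let r_gt0 : (0 < r)%R. Proof. by case/andP: r01. Qed.
Let onemr_gt0 : (0 < 1 - r)%R. Proof. by case/andP: r01; rewrite subr_gt0. Qed.
Let xi_gt0 : (0 < xi)%R. Proof. by case/andP: xi01. Qed.
Let onemr_neq0 : (1 - r != 0)%R. Proof. by rewrite gt_eqF. Qed.

Let mZ (B : set R) : measurable B -> measurable [set w | B (Z w)].
Proof. exact: measurable_RV_preimage. Qed.

Lemma measurable_le (a : R) : measurable [set y : R | y <= a]%R.
Proof. by rewrite -set_itvNyc. Qed.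

Lemma measurable_oc (a b : R) : measurable [set y : R | a < y <= b]%R.
Proof. by rewrite -set_itvoc. Qed.

Lemma probability_ge (j : nat) :
  P [set w | - j%:R <= Z w]%R = (1 - xi * r ^+ j.+1)%:E.
Proof.
rewrite EFinB -lower_tail -probability_setC; last exact: (mZ _ (measurable_le _)).
congr (P _); apply/seteqP; split => w /= jZ.
  apply/negP; rewrite -ltNge; apply: lt_le_trans jZ.
  by rewrite ltrN2 ltr_nat.
move/negP: jZ; rewrite -ltNge intr_ltE ?rpredN ?natr_int//.
by rewrite -natr1 opprD subrK.
Qed.

Lemma probability_point (j : nat) :
  P [set w | Z w = - j%:R]%R = (xi * (1 - r) * r ^+ j)%:E.
Proof.
have E : [set w | Z w <= - j%:R]%R =
    [set w | Z w = - j%:R]%R `|` [set w | Z w <= - j.+1%:R]%R.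
  apply/seteqP; split => w /=.
    rewrite le_eqVlt => /predU1P[->|]; first by left.
    rewrite intr_ltE ?rpredN ?natr_int// => H; right.
    by rewrite -natr1 opprD lerBrDr.
  move=> [->//|] /le_trans; apply.
  by rewrite lerN2 ler_nat.
have : P [set w | Z w <= - j%:R]%R =
    P [set w | Z w = - j%:R]%R + P [set w | Z w <= - j.+1%:R]%R.
  rewrite E; apply: measureU.
  - exact: (mZ [set _]).
  - exact: (mZ _ (measurable_le _)).
  - apply/seteqP; split=> // w /= [->].
    by rewrite lerN2 ler_nat ltnn.
rewrite !lower_tail => /(congr1 (fun x => x - (xi * r ^+ j.+1)%:E)).
rewrite addeK// => <-; rewrite -EFinB exprS; congr EFin; ring.
Qed.

Lemma sum_geometric (a : R) : (0 <= a)%R ->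
  \sum_(i <oo) (a * r ^+ i)%:E = (a / (1 - r))%:E.
Proof.
move=> a0; have rn : (`|r| < 1)%R by rewrite ger0_norm ?ltW//; case/andP: r01.
apply/cvg_lim => //.
rewrite (_ : (fun n => _) = EFin \o series (geometric a r)).
  by apply: cvg_EFin => //; [exact: nearW|exact: cvg_geometric_series].
by apply/funext => n /=; rewrite sumEFin.
Qed.

Lemma expectation_neg : \int[P]_w (maxe (- Z w)%:E 0) = (xi * r / (1 - r))%:E.
Proof.
rewrite (@expectation_pos_tail _ _ _ P (fun w => - Z w)%R).
- rewrite -sum_geometric; last by rewrite mulr_ge0// ltW.
  apply: eq_eseriesr => i _; rewrite -mulrA -exprS -lower_tail; congr (P _).
  apply/seteqP; split => w /=; rewrite intr_ltE ?rpredN ?natr_int ?Z_int//.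
    by rewrite natr1 lerNr.
  by rewrite natr1 lerNr.
- exact: measurable_funN.
- by move=> w; rewrite rpredN.
Qed.

(** The negative part has finite expectation, so an infinite positive part would make the mean
    [+oo], against [mean_lt0]. *)
Lemma expectation_posE : exists2 e : R,
  \int[P]_w (maxe (Z w)%:E 0) = e%:E & 'E_P[Z] = (e - xi * r / (1 - r))%:E.
Proof.
have EZ : 'E_P[Z] = \int[P]_w (maxe (Z w)%:E 0) - (xi * r / (1 - r))%:E.
  rewrite unlock integralE -expectation_neg; congr (_ - _).
    by apply: eq_integral => w _; rewrite funeposE.
  by apply: eq_integral => w _; rewrite funenegE.
have : \int[P]_w (maxe (Z w)%:E 0) \is a fin_num.
  rewrite ge0_fin_numE; last first.
    by apply: integral_ge0 => w _; rewrite le_max lexx orbT.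
  move: mean_lt0; rewrite EZ.
  by case: (\int[P]_w (maxe (Z w)%:E 0)) => [a||]//=; rewrite ltry.
move=> /fineK pos_fin; exists (fine (\int[P]_w (maxe (Z w)%:E 0))) => //.
by rewrite EZ EFinB pos_fin.
Qed.

(** The series is the expectation of the positive part of [Z + j]. Raising [j] by one adds
    [P(Z >= -j)], known from [probability_ge]. *)
Lemma partial_mean (e : R) (j : nat) : \int[P]_w (maxe (Z w)%:E 0) = e%:E ->
  \sum_(i <oo) i%:R%:E * P [set w | Z w = i%:R - j%:R]%R =
  (e + j%:R - xi * r * (1 - r ^+ j) / (1 - r))%:E.
Proof.
move=> eE; elim: j => [|j IH].
  rewrite expr0 subrr mulr0 mul0r subr0 addr0 -eE (expectation_pos_point P)//.
  by apply: eq_eseriesr => i _; rewrite subr0.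
rewrite nneseries_recS; last by move=> i; rewrite mule_ge0// lee_fin.
rewrite [X in X + _ = _](mul0e _) add0e.
transitivity (\sum_(i <oo) (i%:R%:E * P [set w | Z w = i%:R - j%:R]%R +
                            P [set w | Z w = i%:R - j%:R]%R)).
  apply: eq_eseriesr => i _.
  have -> : (i.+1%:R - j.+1%:R = i%:R - j%:R :> R)%R by rewrite -!natr1; ring.
  by rewrite -natr1 EFinD ge0_muleDl// mul1e.
rewrite nneseriesD//; last by move=> i _ _; rewrite mule_ge0// lee_fin.
rewrite [X in X + _ = _]IH.
rewrite [X in _ + X = _](sum_point_probability P)// ?rpredN ?natr_int//.
rewrite probability_ge -EFinD; congr EFin.
by rewrite -natr1 exprS; field.
Qed.

Lemma geometric_occupation (c : R) (g : nat -> nat -> \bar R) :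
  (0 <= c)%R -> (forall n j, 0 <= g n j) ->
  (forall j, g 0%N j = (c * (xi * r ^+ j.+1))%:E) ->
  (forall n j, g n.+1 j =
    \sum_(i <oo) g n i * P [set w | Z w = i%:R - j%:R]%R) ->
  forall j, \sum_(n <oo) g n j = c%:E.
Proof.
move=> c0 g_ge0 g0 gS; have [e eE meanE] := expectation_posE.
have inv_ge0 : (0 <= (1 - r)^-1)%R by rewrite invr_ge0 ltW.
(* The drift of [j + 1 / (1 - r)] is exactly the mean: the geometric overshoot
   below the barrier is compensated by the constant. *)
pose V j : \bar R := (j%:R + (1 - r)^-1)%:E.
(* Here [mu] is minus the mean of [Z], and the missing mass [q j] of column [j] is [P(Z < -j)]. *)
apply: (@killed_chain_occupation _ (fun i j => P [set w | Z w = i%:R - j%:R]%R)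
  _ V (- (e - xi * r / (1 - r)))%R c (fun j => xi * r ^+ j.+1)%R) => //.
- by rewrite oppr_gt0 -lte_fin -meanE.
- by move=> j; rewrite lee_fin addr_ge0.
- move=> j.
  have VE : \sum_(i <oo) V i * P [set w | Z w = i%:R - j%:R]%R =
      \sum_(i <oo) i%:R%:E * P [set w | Z w = i%:R - j%:R]%R +
      (1 - r)^-1%:E * \sum_(i <oo) P [set w | Z w = i%:R - j%:R]%R.
    rewrite -nneseriesZl// -nneseriesD.
    - by apply: eq_eseriesr => i _; rewrite /V EFinD ge0_muleDl// lee_fin.
    - by move=> i _ _; rewrite mule_ge0// lee_fin.
    - by move=> i _ _; rewrite mule_ge0// lee_fin.
  rewrite VE (partial_mean e)// (sum_point_probability P)// ?rpredN ?natr_int//.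
  rewrite probability_ge -EFinM -!EFinD; congr EFin.
  by rewrite exprS; field.
- move=> j; rewrite (sum_point_probability P)// ?rpredN ?natr_int//.
  by rewrite probability_ge -EFinD; congr EFin; ring.
Qed.

(** Widening the window from [x] to [x + 1] adds the points [Z = i + x + 1]; over all [i] these make
    up the event [Z >= x + 1]. *)
Lemma sum_window (x : nat) :
  \sum_(i <oo) P [set w | i%:R < Z w <= x%:R + i%:R]%R =
  \sum_(1 <= m < x.+1) P [set w | m%:R <= Z w]%R.
Proof.
elim: x => [|x IH].
  rewrite big_geq// eseries0// => i _ _; rewrite (_ : mkset _ = set0) ?measure0//.
  by apply/seteqP; split=> // w /= /andP[/lt_le_trans/[apply]]; rewrite add0r ltxx.
rewrite big_nat_recr//= -IH -(sum_point_probability P)// ?natr_int//.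
rewrite -nneseriesD//; apply: eq_eseriesr => i _.
transitivity (P ([set w | i%:R < Z w <= x%:R + i%:R]%R `|`
                 [set w | Z w = i%:R + x.+1%:R]%R)).
- congr (P _); apply/seteqP; split => w /=.
    move=> /andP[iZ]; rewrite le_eqVlt => /predU1P[->|]; first by right; rewrite addrC.
    rewrite intr_ltE ?rpredD ?natr_int// -natr1 => Zx; left; rewrite iZ/=.
    by move: Zx; lra.
  move=> [/andP[-> /= /le_trans]|->].
    by apply; rewrite lerD2r ler_nat.
  by rewrite ltrDl ltr0n/= addrC.
apply: measureU.
- exact: (mZ _ (measurable_oc _ _)).
- exact: (mZ [set _]).
- apply/seteqP; split=> // w /= [/andP[_ Zx] ZE].
  by move: Zx; rewrite ZE addrC lerD2r ler_nat ltnn.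
Qed.

End geometric_lower_tail.

(** * Paths staying below a barrier, and independence of the next step *)

Section walk.
Context {d : measure_display} {T : measurableType d} {R : realType}.
Variables (P : probability T R) (X : nat -> {RV P >-> R}).
Local Notation X' := (fun n => X n : T -> R).
Hypothesis X_indep : mutually_independent P X'.
Hypothesis X_ident : identically_distributed P X'.
Hypothesis X_int : forall n w, X n w \is a Num.int.

Lemma S_int n w : S X' n w \is a Num.int.
Proof. by apply: rpred_sum => i _; exact: X_int. Qed.

Lemma measurable_X n (B : set R) : measurable B -> measurable (X n @^-1` B).
Proof.
by move=> mB; rewrite -[_ @^-1` _]setTI; exact: measurable_funPT.
Qed.

Lemma S_recr n w : S X' n.+1 w = S X' n w + X n w.
Proof. by rewrite /S big_ord_recr. Qed.

(* Only [S_1], ..., [S_(n+1)] are constrained: [S_0 = 0] may lie above the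
   barrier [-K], and the index [n] stands for [n.+1] steps. *)
Definition stays_below (K n : nat) : set T :=
  [set w | forall m, (m <= n)%N -> S X' m.+1 w <= - K%:R].

Definition below_at (K n i : nat) : set T :=
  [set w | stays_below K n w /\ S X' n.+1 w = - (K + i)%:R].

Lemma stays_below_bigcup K n :
  stays_below K n = \bigcup_i below_at K n i.
Proof.
apply/seteqP; split=> [w Kw|w [i _ []//]].
have : - K%:R - S X' n.+1 w \is a Num.nat.
  by rewrite natrEint subr_ge0 Kw// rpredB ?S_int ?rpredN ?natr_int.
move=> /natrP[i Hi]; exists i => //; split => //.
by rewrite natrD -Hi; ring.
Qed.

Lemma trivIset_below_at K n : trivIset setT (below_at K n).
Proof.
apply/trivIsetP => i j _ _ ij; apply/seteqP; split=> // w [] [_ Si] [_].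
by rewrite Si => /oppr_inj/eqP; rewrite eqr_nat eqn_add2l (negbTE ij).
Qed.

(** Splits by the last position under the barrier. As [C] is arbitrary, this covers both continuing
    below the barrier and leaving it. *)
Lemma cross_bigcup K n (C : set R) :
  stays_below K n `&` [set w | C (S X' n.+2 w)] =
  \bigcup_i (below_at K n i `&` X n.+1 @^-1` [set x | C (x - (K + i)%:R)]).
Proof.
rewrite stays_below_bigcup setI_bigcupl; apply: eq_bigcup => // i _.
apply/seteqP; split=> w [[Kw Sw]] /=; rewrite S_recr Sw addrC => Cw; split=> //.
Qed.

Lemma below_atS K n j : below_at K n.+1 j =
  \bigcup_i (below_at K n i `&` X n.+1 @^-1` [set (i%:R - j%:R)%R]).
Proof.
(* The endpoint [-(K + j)] already lies below the barrier, so the constraint on the last step is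
   automatic. *)
have -> : below_at K n.+1 j =
    stays_below K n `&` [set w | [set - (K + j)%:R] (S X' n.+2 w)].
  apply/seteqP; split => w [Kw Sw]; split=> //.
    by move=> m mn; exact/Kw/ltnW.
  move=> m; rewrite leq_eqVlt => /predU1P[->|]; last exact: Kw.
  by rewrite Sw lerN2 ler_nat leq_addr.
rewrite cross_bigcup; apply: eq_bigcup => // i _; congr (_ `&` _).
rewrite !natrD; apply/seteqP; split => w /= Hw; last by rewrite Hw; ring.
by apply: (addIr (- (K%:R + i%:R))); rewrite Hw; ring.
Qed.

Lemma below_at0 K j : below_at K 0 j = X 0%N @^-1` [set - (K + j)%:R].
Proof.
apply/seteqP; split => [w [_]|w Xw]; first by rewrite /S big_ord1.
have Sw : S X' 1 w = - (K + j)%:R by rewrite /S big_ord1.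
split=> // m; rewrite leqn0 => /eqP ->.
by rewrite Sw lerN2 ler_nat leq_addr.
Qed.

Lemma measurable_below_at K n i : measurable (below_at K n i).
Proof.
elim: n i => [|n IH] j; first by rewrite below_at0; exact: measurable_X.
rewrite below_atS; apply: bigcup_measurable => i _.
by apply: measurableI; [exact: IH|exact: measurable_X].
Qed.

Lemma bigcap_I_recl (A : nat -> set T) m :
  \bigcap_(l in `I_m.+1) A l = A 0%N `&` \bigcap_(l in `I_m) A l.+1.
Proof.
apply/seteqP; split=> w.
  by move=> Aw; split=> [|l lm]; exact: Aw.
by move=> [A0 Aw] [|l] lm//; exact: Aw.
Qed.

Local Open Scope ereal_scope.

(* Testing against all later steps at once lets the induction on [n] consume
   the next step as one more factor of the box. *)
Lemma below_at_indep K n i m (B : nat -> set R) : (forall l, measurable (B l)) ->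
  P (below_at K n i `&` \bigcap_(l in `I_m) X (n.+1 + l)%N @^-1` B l) =
  P (below_at K n i) * \prod_(l < m) P (X 0%N @^-1` B l).
Proof.
elim: n i m B => [|n IH] j m B mB.
  rewrite below_at0.
  pose B' l := if l is l'.+1 then B l' else [set (- (K + j)%:R)%R].
  have mB' l : measurable (B' l) by case: l => [|l] /=.
  have := X_indep m.+1 _ mB'.
  rewrite bigcap_I_recl big_ord_recl /= => ->.
  congr (_ * _); apply: eq_bigr => l _; exact: X_ident.
rewrite below_atS setI_bigcupl.
(* The box [B' i] puts in front of [B] the single jump leading from depth [i] to depth [j]. *)
pose B' i l := if l is l'.+1 then B l' else [set (i%:R - j%:R)%R].
have mB' i l : measurable (B' i l) by case: l => [|l] /=.
have mX1 i : measurable (below_at K n i `&` X n.+1 @^-1` [set (i%:R - j%:R)%R]).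
  by apply: measurableI; [exact: measurable_below_at|exact: measurable_X].
have mXB : measurable (\bigcap_(l in `I_m) X (n.+2 + l)%N @^-1` B l).
  by apply: bigcap_measurableType => l _; exact: measurable_X.
have triv : trivIset setT
    (fun i => below_at K n i `&` X n.+1 @^-1` [set (i%:R - j%:R)%R]).
  exact/trivIset_setIr/trivIset_below_at.
rewrite !measure_bigcup_nat//; last 2 first.
- by move=> i; exact: measurableI.
- exact: trivIset_setIr.
have -> : \prod_(l < m) P (X 0%N @^-1` B l) =
    (fine (\prod_(l < m) P (X 0%N @^-1` B l)))%:E.
  rewrite fineK//; apply: prode_fin_num => l _; apply: fin_num_measure.
  exact: measurable_X.
rewrite muleC -nneseriesZl//; apply: eq_eseriesr => i _.
rewrite fineK; last first.
  by apply: prode_fin_num => l _; apply: fin_num_measure; exact: measurable_X.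
(* [H2] factors the past from the whole enlarged box; [H1], read backwards, joins the past with the
   jump alone. *)
have H1 := IH i 1%N _ (mB' i).
have H2 := IH i m.+1 _ (mB' i).
rewrite -setIA.
transitivity (P (below_at K n i `&`
    \bigcap_(l in `I_m.+1) X (n.+1 + l)%N @^-1` B' i l)).
  congr (P _); rewrite bigcap_I_recl addn0; congr (_ `&` (_ `&` _)).
  by apply: eq_bigcapr => l _; rewrite addnS.
rewrite H2 big_ord_recl.
transitivity (P (below_at K n i `&`
    \bigcap_(l in `I_1) X (n.+1 + l)%N @^-1` B' i l) *
    \prod_(l < m) P (X 0%N @^-1` B l)).
  by rewrite H1 big_ord_recl big_ord0 mule1 muleA.
rewrite muleC; congr (_ * P _); rewrite bigcap_I_recl addn0 -[RHS]setIT.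
by rewrite -setIA; congr (_ `&` (_ `&` _)); rewrite -subTset => w _ l.
Qed.

Lemma below_at_step K n i (B : set R) : measurable B ->
  P (below_at K n i `&` X n.+1 @^-1` B) = P (below_at K n i) * P (X 0%N @^-1` B).
Proof.
move=> mB; have := @below_at_indep K n i 1 (fun=> B) (fun=> mB).
rewrite big_ord_recl big_ord0 mule1 => <-; congr (P (_ `&` _)).
apply/seteqP; split => w Bw.
  by move=> [|//] _; rewrite addn0.
by have := Bw 0%N; rewrite addn0; exact.
Qed.

Lemma measurable_shift (C : set R) (a : R) : measurable C ->
  measurable [set x | C (x - a)%R].
Proof.
move=> mC; rewrite -[X in measurable X]setTI.
have mf : measurable_fun setT (fun x : R => x - a)%R.
  exact: measurable_funB.
exact: mf.
Qed.

Lemma measure_cross K n (C : set R) : measurable C ->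
  P (stays_below K n `&` [set w | C (S X' n.+2 w)]) =
  \sum_(i <oo) P (below_at K n i) * P [set w | C (X 0%N w - (K + i)%:R)%R].
Proof.
move=> mC; rewrite cross_bigcup measure_bigcup_nat//.
- apply: eq_eseriesr => i _; apply: below_at_step; exact: measurable_shift.
- move=> i; apply: measurableI; first exact: measurable_below_at.
  by apply: measurable_X; exact: measurable_shift.
- exact/trivIset_setIr/trivIset_below_at.
Qed.

Lemma measure_below_atS K n j : P (below_at K n.+1 j) =
  \sum_(i <oo) P (below_at K n i) * P [set w | X 0%N w = i%:R - j%:R :> R]%R.
Proof.
rewrite below_atS measure_bigcup_nat//.
- by apply: eq_eseriesr => i _; apply: below_at_step.
- move=> i; apply: measurableI; first exact: measurable_below_at.
  exact: measurable_X.
- exact/trivIset_setIr/trivIset_below_at.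
Qed.

End walk.

(** * Evaluation of [zeta], [L] and [p] *)

Section ladder.
Context {d : measure_display} {T : measurableType d} {R : realType}.
Variables (P : probability T R) (X : nat -> {RV P >-> R}) (xi r : R).
Local Notation X' := (fun n => X n : T -> R).
Hypothesis X_indep : mutually_independent P X'.
Hypothesis X_ident : identically_distributed P X'.
Hypothesis X_int : forall n w, X n w \is a Num.int.
Hypothesis mean_lt0 : ('E_P[X 0%N] < 0)%E.
Hypothesis xi01 : 0 < xi < 1.
Hypothesis r01 : 0 < r < 1.
Hypothesis lower_tail :
  forall k : nat, Fdist P X' (- k%:R) = (xi * r ^+ k)%:E.
Local Open Scope ereal_scope.

Let r_gt0 : (0 < r)%R. Proof. by case/andP: r01. Qed.
Let r_neq0 : (r != 0)%R. Proof. by rewrite gt_eqF. Qed.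
Let onemr_gt0 : (0 < 1 - r)%R. Proof. by case/andP: r01; rewrite subr_gt0. Qed.
Let onemr_neq0 : (1 - r != 0)%R. Proof. by rewrite gt_eqF. Qed.

Let X0_meas : measurable_fun setT (X 0%N : T -> R). Proof. exact: measurable_funPT. Qed.
Let mX0 (B : set R) : measurable B -> measurable [set w | B (X 0%N w)].
Proof. exact: measurable_RV_preimage. Qed.

(* [c = r ^ (K - 1) * (1 - r)], multiplied by [r] because [K - 1] would be
   truncated at [K = 0]. *)
Lemma below_occupation (K : nat) (c : R) : (0 <= c)%R -> (c * r = (1 - r) * r ^+ K)%R ->
  forall j, \sum_(n <oo) P (below_at P X K n j) = c%:E.
Proof.
move=> c0 cE.
apply: (geometric_occupation P (X 0%N) xi r X0_meas (X_int 0%N) xi01 r01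
  lower_tail mean_lt0) => //.
- move=> j; rewrite below_at0.
  rewrite (probability_point P (X 0%N) xi r X0_meas (X_int 0%N) lower_tail).
  congr EFin; rewrite exprD exprS.
  transitivity (c * r * (xi * r ^+ j))%R; last by ring.
  by rewrite cE; ring.
- by move=> n j; exact: measure_below_atS.
Qed.

(** After exchanging the sums over time and position, every position carries the same total
    occupation [c], which factors out. *)
Lemma cross_sum (K : nat) (c : R) (C : set R) : (0 <= c)%R ->
  (c * r = (1 - r) * r ^+ K)%R -> measurable C ->
  \sum_(n <oo) P (stays_below P X K n `&` [set w | C (S X' n.+2 w)]) =
  c%:E * \sum_(i <oo) P [set w | C (X 0%N w - (K + i)%:R)%R].
Proof.
move=> c0 cE mC.
transitivity (\sum_(n <oo) \sum_(i <oo)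
    P (below_at P X K n i) * P [set w | C (X 0%N w - (K + i)%:R)%R]).
  by apply: eq_eseriesr => n _; exact: measure_cross.
rewrite nneseries_interchange; last by move=> n i; rewrite mule_ge0.
rewrite -nneseriesZl//; apply: eq_eseriesr => i _.
have fin : P [set w | C (X 0%N w - (K + i)%:R)%R] \is a fin_num.
  by apply: fin_num_measure; exact: (mX0 _ (measurable_shift _ _ mC)).
rewrite -(fineK fin) [RHS]muleC -(below_occupation K c c0 cE i) -nneseriesZl//.
by apply: eq_eseriesr => n _; rewrite muleC.
Qed.

(** The first step contributes [P(X = 0) = xi * (1 - r)]. Later returns use the barrier [K = 1],
    since integer values below [0] are at most [-1], and contribute
    [(1 - r) * P(X >= 1) = (1 - r) * (1 - xi)]. *)
Lemma zetaE : zeta P X' = (1 - r)%:E.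
Proof.
rewrite /zeta -nneseries_addn// nneseries_recS//.
(* The one-step term stands apart because [stays_below] constrains at least one sum; [- 0%:R] is the
   form that [probability_point] takes at [j = 0]. *)
transitivity (P [set w | X 0%N w = - 0%:R]%R +
   \sum_(n <oo) P (stays_below P X 1 n `&` [set w | [set 0%R] (S X' n.+2 w)])).
  congr (_ + _).
    rewrite add0n; congr (P _); apply/seteqP; split => w /=.
      by rewrite {2}/S big_ord1 oppr0; case.
    by rewrite {2}/S big_ord1 oppr0 => X0; split=> // -[].
  apply: eq_eseriesr => n _; rewrite addn1; congr (P _).
  apply/seteqP; split => w /= [Sneg S0]; split => //.
    move=> m mn; have := Sneg m.+1; rewrite !ltnS mn => /(_ isT).
    rewrite intr_ltE ?S_int// lerNr; lra.
  move=> [|k]//=; rewrite !ltnS => kn; have := Sneg _ kn; lra.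
rewrite (cross_sum 1 (1 - r)) ?ltW//.
rewrite (probability_point P (X 0%N) xi r X0_meas (X_int 0%N) lower_tail).
have -> : \sum_(i <oo) P [set w | [set 0%R] (X 0%N w - (1 + i)%:R)%R] =
    P [set w | 1 <= X 0%N w]%R.
  rewrite -(sum_point_probability P (X 0%N) X0_meas (X_int 0%N) 1)//.
  apply: eq_eseriesr => i _; congr (P _); apply/seteqP.
  by split => w /=; rewrite natrD; lra.
have -> : P [set w | 1 <= X 0%N w]%R = (1 - xi)%:E.
  have := lower_tail 0; rewrite expr0 mulr1 => F0.
  rewrite EFinB -F0 -probability_setC; last exact: (mX0 _ (measurable_le _)).
  congr (P _); apply/seteqP; split => w /=; rewrite oppr0.
    by move=> X1; apply/negP; rewrite -ltNge; apply: lt_le_trans X1.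
  by move/negP; rewrite -ltNge intr_ltE ?add0r.
by rewrite -EFinM -EFinD; congr EFin; ring.
Qed.

(** [S 0 = 0] is the default value of the maximum, which is therefore never negative; it equals [0]
    when no later sum is positive. *)
Lemma bigmax_walkP n w :
  \big[Num.max/S X' 0 w]_(k < n.+1) S X' k w = 0%R <->
  (forall m, (m < n)%N -> S X' m.+1 w <= 0)%R.
Proof.
have S0 : S X' 0 w = 0%R by rewrite /S big_ord0.
split=> [max0 m mn|Sle].
  have := le_bigmax (S X' 0 w) (fun k : 'I_n.+1 => S X' k w)
    (Ordinal (mn : (m.+1 < n.+1)%N)).
  by rewrite max0.
apply/eqP; rewrite eq_le; apply/andP; split.
  apply: bigmax_le; rewrite ?S0// => -[[|k] kn] _ /=; rewrite ?S0//.
  exact: Sle.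
by rewrite -[leLHS]S0; exact: bigmax_ge_id.
Qed.

Let c0 : R := ((1 - r) / r)%R.
Let c0_ge0 : (0 <= c0)%R. Proof. by rewrite divr_ge0// ltW. Qed.
Let c0E : (c0 * r = (1 - r) * r ^+ 0)%R. Proof. by rewrite /c0 expr0 mulr1 divfK. Qed.

(** A jump from [-i] into [(0, x]] has size in [(i, x + i]]; [sum_window] adds these probabilities
    over [i]. *)
Lemma LmeasE (x : nat) : Lmeas P X' `]0%R, x%:R]%classic =
  P [set w | 0 < X 0%N w <= x%:R]%R +
  c0%:E * \sum_(1 <= m < x.+1) P [set w | m%:R <= X 0%N w]%R.
Proof.
rewrite /Lmeas -nneseries_addn// nneseries_recS//.
rewrite -(sum_window P (X 0%N) X0_meas (X_int 0%N)).
transitivity (P [set w | 0 < X 0%N w <= x%:R]%R +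
   \sum_(n <oo) P (stays_below P X 0 n `&`
     [set w | [set y | 0 < y <= x%:R]%R (S X' n.+2 w)])).
  congr (_ + _).
    rewrite add0n; congr (P _); apply/seteqP; split => w /=.
      by rewrite /S !big_ord1 in_itv/= => -[_ []].
    move=> X0; split; first by apply/bigmax_walkP.
    by rewrite /S big_ord1 in_itv/=; case/andP: X0 => -> ->.
  apply: eq_eseriesr => n _; rewrite addn1; congr (P _).
  apply/seteqP; split => w /=.
    move=> [/bigmax_walkP Sle [_]]; rewrite in_itv => SC; split=> // m mn.
    by rewrite oppr0; exact: Sle.
  move=> [Sle SC]; split; first apply/bigmax_walkP.
    by move=> m mn; rewrite -oppr0; exact: Sle.
  by rewrite in_itv/=; case/andP: SC => -> ->.
rewrite (cross_sum 0 c0)//; last exact: measurable_oc.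
congr (_ + _ * _); apply: eq_eseriesr => i _; congr (P _).
by apply/seteqP; split => w /=; rewrite add0n subr_gt0 lerBlDr.
Qed.

Lemma p_supE : p_sup P X' =
  P [set w | 0 < X 0%N w]%R + c0%:E * \sum_(i <oo) P [set w | i%:R < X 0%N w]%R.
Proof.
(* [A n] says that the walk is first positive at time [n + 1]; time [0] is excluded by [S 0 = 0]. *)
pose A n := [set w | (forall m, (m < n)%N -> S X' m.+1 w <= 0)%R /\
                     (0 < S X' n.+1 w)%R].
have AS n : A n.+1 = stays_below P X 0 n `&` [set w | [set y | 0 < y]%R (S X' n.+2 w)].
  apply/seteqP; split => w /= [Sle Sgt]; split => // m mn.
    by rewrite oppr0; exact: Sle.
  by have := Sle m mn; rewrite oppr0.
have A0 : A 0%N = [set w | 0 < X 0%N w]%R.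
  apply/seteqP; split => w /=; first by rewrite /A /S/= big_ord1 => -[].
  by move=> X0; split=> //; rewrite /S big_ord1.
have mA n : measurable (A n).
  case: n => [|n]; first by rewrite A0; exact: (mX0 _ (measurable_gt _)).
  rewrite AS cross_bigcup//; apply: bigcup_measurable => i _.
  apply: measurableI; first exact: measurable_below_at.
  by apply: measurable_X; apply: measurable_shift; exact: measurable_gt.
have tA : trivIset setT A.
  apply: ltn_trivIset => n m mn; apply/seteqP; split=> // w /= [[_ Sm] [Sle _]].
  by have := Sle m mn; rewrite leNgt Sm.
rewrite /p_sup (_ : mkset _ = \bigcup_n A n); last first.
  apply/seteqP; split => w /=; last by move=> [n _ [_ Sn]]; exists n.+1.
  move=> ex; case: (ex_minnP ex) => -[|k] Sk mink.
    by move: Sk; rewrite /S big_ord0 ltxx.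
  exists k => //; split => // m mk; rewrite leNgt; apply/negP => /mink.
  by rewrite ltnS leqNgt mk.
rewrite measure_bigcup_nat// nneseries_recS// A0; congr (_ + _).
transitivity (\sum_(n <oo) P (stays_below P X 0 n `&`
    [set w | [set y | 0 < y]%R (S X' n.+2 w)])).
  by apply: eq_eseriesr => n _; rewrite AS.
rewrite (cross_sum 0 c0)//; last exact: measurable_gt.
congr (_ * _); apply: eq_eseriesr => i _; congr (P _).
by apply/seteqP; split => w /=; rewrite add0n subr_gt0.
Qed.

Lemma probability_ge_compl (m : nat) :
  P [set w | m.+1%:R <= X 0%N w]%R = 1 - Fdist P X' m%:R.
Proof.
rewrite -probability_setC; last exact: (mX0 _ (measurable_le _)).
congr (P _); apply/seteqP; split => w /=.
  by move=> X1; apply/negP; rewrite -ltNge; apply: lt_le_trans X1; rewrite ltr_nat.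
by move/negP; rewrite -ltNge intr_ltE ?natr_int// natr1.
Qed.

Lemma probability_oc (x : R) : (0 <= x)%R ->
  P [set w | 0 < X 0%N w <= x]%R = Fdist P X' x - Fdist P X' 0.
Proof.
move=> x0.
have -> : Fdist P X' x = P [set w | 0 < X 0%N w <= x]%R + Fdist P X' 0.
  transitivity (P ([set w | 0 < X 0%N w <= x]%R `|` [set w | X 0%N w <= 0]%R)).
    congr (P _); apply/seteqP; split => w /=.
      by move=> ->; rewrite andbT; case: (ltP 0%R (X 0%N w)); [left|right].
    by move=> [/andP[_ ->//]|/le_trans]; exact.
  apply: measureU.
  - exact: (mX0 _ (measurable_oc _ _)).
  - exact: (mX0 _ (measurable_le _)).
  - by apply/seteqP; split=> // w /= [/andP[X0 _]]; rewrite leNgt X0.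
by rewrite addeK//; apply: fin_num_measure; exact: (mX0 _ (measurable_le _)).
Qed.

(** With [e] the mean of the positive part, both sides equal [r * (1 - xi) + (1 - r) * e]: on the
    left [1 - zeta = r] cancels the denominator of [c0], on the right the negative part contributes
    [- xi * r]. *)
Lemma ladder_p_sup :
  (1 - zeta P X') * p_sup P X' = r%:E + (1 - r)%:E * 'E_P[X 0%N].
Proof.
have [e eE ->] := expectation_posE P (X 0%N) xi r X0_meas (X_int 0%N) xi01 r01
  lower_tail mean_lt0.
have F0 : Fdist P X' 0 = xi%:E.
  by have := lower_tail 0; rewrite expr0 mulr1 oppr0.
rewrite zetaE p_supE -(expectation_pos_tail P (X 0%N) X0_meas (X_int 0%N)) eE.
have -> : P [set w | 0 < X 0%N w]%R = (1 - xi)%:E.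
  rewrite EFinB -F0 -[RHS](probability_ge_compl 0); congr (P _).
  by apply/seteqP; split => w /=; rewrite intr_ltE// add0r.
rewrite -!(EFinM, EFinB, EFinD); congr EFin; rewrite /c0; field.
by rewrite onemr_neq0 r_neq0.
Qed.

Lemma ladder_Lmeas (x : nat) : (0 < x)%N ->
  (1 - zeta P X') * Lmeas P X' `]0%R, x%:R]%classic =
  Fdist P X' x%:R - Fdist P X' 0 +
  (1 - r)%:E * \sum_(1 <= m < x.+1) (1 - Fdist P X' m%:R).
Proof.
move=> x0.
(* The distribution function is replaced by its real values, so that the identity can be settled by
   [field]. *)
pose f m : R := fine (Fdist P X' m%:R).
have fE m : Fdist P X' m%:R = (f m)%:E.
  by rewrite fineK//; apply: fin_num_measure; exact: (mX0 _ (measurable_le _)).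
have f0E : Fdist P X' 0 = (f 0%N)%:E := fE 0%N.
rewrite zetaE LmeasE probability_oc// f0E !fE.
rewrite big_add1/=.
under eq_bigr do rewrite probability_ge_compl fE -EFinB.
under [in RHS]eq_bigr do rewrite fE -EFinB.
rewrite !sumEFin -!(EFinM, EFinB, EFinD); congr EFin.
(* Since [P(X >= m) = 1 - F(m - 1)], the sum from [LmeasE] runs over [0, ..., x - 1]. Shifting it to
   [1, ..., x] costs [F(x) - F(0)], which completes the coefficient [r] of that difference to
   [1]. *)
have sumE : (\sum_(1 <= m < x.+1) (1 - f m) =
    \sum_(0 <= m < x) (1 - f m) + f 0%N - f x)%R.
  have recr : (\sum_(0 <= m < x.+1) (1 - f m) =
    \sum_(0 <= m < x) (1 - f m) + (1 - f x))%R by rewrite big_nat_recr.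
  have : (\sum_(0 <= m < x.+1) (1 - f m) =
    1 - f 0%N + \sum_(1 <= m < x.+1) (1 - f m))%R by rewrite big_ltn.
  by rewrite recr; lra.
by rewrite sumE /c0; field.
Qed.

End ladder.

Theorem mainTheorem3 (d : measure_display) (T : measurableType d) (R : realType)
  (P : probability T R) (X : nat -> {RV P >-> R}) (xi r : R) :
  (* i.i.d. integer-valued steps X 0, X 1, ... (the paper's X_1, X_2, ...) *)
  mutually_independent P (fun n => X n : T -> R) ->
  identically_distributed P (fun n => X n : T -> R) ->
  (forall n w, X n w \is a Num.int) ->
  (* F not concentrated on a half-axis *)
  (0 < P [set w | (X 0%N w < 0)%R])%E ->
  (0 < P [set w | (0 < X 0%N w)%R])%E ->
  (* negative mean *)
  ('E_P[X 0%N] < 0)%E ->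
  0 < xi < 1 -> 0 < r < 1 ->
  (* F(x) = xi r^{-x} for x = 0,-1,-2,... *)
  (forall k : nat, Fdist P (fun n => X n : T -> R) (- k%:R) = (xi * r ^+ k)%:E) ->
  ((1 - zeta P (fun n => X n : T -> R)) * p_sup P (fun n => X n : T -> R)
     = r%:E + (1 - r)%:E * 'E_P[X 0%N])%E
  /\
  (forall x : nat, (0 < x)%N ->
     ((1 - zeta P (fun n => X n : T -> R)) * Lmeas P (fun n => X n : T -> R) `]0%R, x%:R]%classic
      = Fdist P (fun n => X n : T -> R) x%:R - Fdist P (fun n => X n : T -> R) 0
        + (1 - r)%:E * \sum_(1 <= m < x.+1) (1 - Fdist P (fun n => X n : T -> R) m%:R))%E).
Proof.
move=> X_indep X_ident X_int _ _ mean_lt0 xi01 r01 lower_tail; split.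
  exact: ladder_p_sup lower_tail.
by move=> x; exact: ladder_Lmeas lower_tail x.
Qed.
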